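(* Let $G$ be a finite group with a representation $\rho_0$ on $\mathbb{R}^{d_0}$, and let $S=\{(\mathbf{x}_i,y_i): i\in[n]\}$ with $\mathbf{x}_i\in\mathbb{R}^{d_0}$, $y_i\in\{\pm1\}$. Let $\boldsymbol\beta_{\mathrm{steer}}^\infty=\lim_{t\to\infty}\frac{\boldsymbol\beta_{\mathrm{steer}}(t)}{\|\boldsymbol\beta_{\mathrm{steer}}(t)\|}$ be the directional limit of the linear predictor $\boldsymbol\beta_{\mathrm{steer}}(t)=\mathcal{P}_{\mathrm{steer}}(\mathbf{W}(t))$ parameterized by a linear steerable network trained using gradient flow on the original data set $S$, assuming $\mathcal{L}_{\mathcal{P}_{\mathrm{steer}}}(\mathbf{W}(t_0);S)<1$ for some $t_0>0$. Let $\boldsymbol\beta_{\mathrm{fc}}^\infty=\lim_{t\to\infty}\frac{\boldsymbol\beta_{\mathrm{fc}}(t)}{\|\boldsymbol\beta_{\mathrm{fc}}(t)\|}$ be the directional limit of $\boldsymbol\beta_{\mathrm{fc}}(t)=\mathcal{P}_{\mathrm{fc}}(\mathbf{W}_{\mathrm{fc}}(t))$ for a linear fully-connected network trained using gradient flow on the augmented data set $S_{\mathrm{aug}}=\{(\rho_0(g)\mathbf{x}_i,y_i): i\in[n],g\in G\}$, assuming $\mathcal{L}_{\mathcal{P}_{\mathrm{fc}}}(\mathbf{W}_{\mathrm{fc}}(t_0');S_{\mathrm{aug}})<1$ for some $t_0'>0$. If $\rho_0$ is unitary, i.e. $\rho_0(g^{-1})=\rho_0(g)^\top$ for all $g\in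 G$, then $$\boldsymbol\beta_{\mathrm{steer}}^\infty=\boldsymbol\beta_{\mathrm{fc}}^\infty.$$
   Context: Notation. $[n]=\{1,\dots,n\}$; $\langle\cdot,\cdot\rangle$ and $\|\cdot\|$ are the Euclidean inner product and norm. $G$ is a finite group and $\rho_0:G\to GL(\mathbb{R}^{d_0})$ a representation. Linear steerable network. Let $L\ge2$. Given finite-dimensional real representations $(\mathcal{X}_l,\rho_l)$ of $G$, $l=0,\dots,L$, with $(\mathcal{X}_0,\rho_0)=(\mathbb{R}^{d_0},\rho_0)$, $(\mathcal{X}_L,\rho_L)=(\mathbb{R},\text{trivial})$, and $(\mathcal{X}_1,\rho_1)$ the regular representation $\mathcal{X}_1=\{\mathbf{x}_1:G\to\mathbb{R}^{d_1}\}$, $(\rho_1(g)\mathbf{x}_1)(h)=\mathbf{x}_1(g^{-1}h)$; the representations $(\mathcal{X}_l,\rho_l)$ for $2\le l\le L-1$ are arbitrary. The first layer is the $G$-lifting map $\Psi_1(\mathbf{x};\mathbf{w}_1)(g)=\mathbf{w}_1^\top\rho_0(g)^{-1}\mathbf{x}\in\mathbb{R}^{d_1}$ with trainable $\mathbf{w}_1\in\mathbb{R}^{d_0\times d_1}$. For $2\le l\le L$, one fixes a finite collection of $G$-equivariant linear maps (intertwiners) $\psi_l^1,\dots,\psi_l^{N_l}:\mathcal{X}_{l-1}\to\mathcal{X}_l$ (not necessarily a basis of all intertwiners) and sets $\Psi_l(\mathbf{x};\mathbf{w}_l)=\sum_{j=1}^{N_l}w_l^j\psi_l^j(\mathbf{x})$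 with trainable $\mathbf{w}_l\in\mathbb{R}^{N_l}$. The network is $f_{\mathrm{steer}}(\mathbf{x};\mathbf{W})=\Psi_L(\cdots\Psi_2(\Psi_1(\mathbf{x};\mathbf{w}_1);\mathbf{w}_2)\cdots;\mathbf{w}_L)$, with $\mathbf{W}=(\mathbf{w}_1,\dots,\mathbf{w}_L)\in\mathcal{W}_{\mathrm{steer}}=\mathbb{R}^{d_0\times d_1}\times\prod_{l=2}^L\mathbb{R}^{N_l}$. For each $\mathbf{W}$ it is linear in $\mathbf{x}$, and $\mathcal{P}_{\mathrm{steer}}(\mathbf{W})\in\mathbb{R}^{d_0}$ denotes the vector with $f_{\mathrm{steer}}(\mathbf{x};\mathbf{W})=\langle\mathbf{x},\mathcal{P}_{\mathrm{steer}}(\mathbf{W})\rangle$ for all $\mathbf{x}$. Linear fully-connected network. With widths $k_0=d_0,k_1,\dots,k_{L-1}\ge1$ and parameters $\mathbf{W}=(\mathbf{w}_1,\dots,\mathbf{w}_L)\in\left(\prod_{l=1}^{L-1}\mathbb{R}^{k_{l-1}\times k_l}\right)\times\mathbb{R}^{k_{L-1}}$, it is $f_{\mathrm{fc}}(\mathbf{x};\mathbf{W})=\langle\mathbf{x},\mathcal{P}_{\mathrm{fc}}(\mathbf{W})\rangle$ with $\mathcal{P}_{\mathrm{fc}}(\mathbf{W})=\mathbf{w}_1\mathbf{w}_2\cdots\mathbf{w}_L\in\mathbb{R}^{d_0}$. Gradient flow. For $\mathcal{P}\in\{\mathcal{P}_{\mathrm{steer}},\mathcal{P}_{\mathrm{fc}}\}$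 and a data set $T$ (a finite family of pairs $(\mathbf{x},y)$, indexed by $[n]$ for $S$ and by $[n]\times G$ for $S_{\mathrm{aug}}$), let $\mathcal{L}_{\mathcal{P}}(\mathbf{W};T)=\sum_{(\mathbf{x},y)\in T}\exp(-y\langle\mathbf{x},\mathcal{P}(\mathbf{W})\rangle)$. Training by gradient flow on $T$ from an initialization $\mathbf{W}(0)$ means following the solution $\{\mathbf{W}(t)\}_{t\ge0}$ of $\frac{d\mathbf{W}}{dt}=-\nabla_{\mathbf{W}}\mathcal{L}_{\mathcal{P}}(\mathbf{W};T)$. Under the assumption that the loss is below $1$ at some positive time, the directional limits in the statement exist. *)

(* Defs.v *)
From HB Require Import structures.
From mathcomp Require Import all_boot all_order all_algebra all_fingroup.
From mathcomp Require Import mxrepresentation.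
From mathcomp Require Import all_classical all_reals all_analysis.

Set Implicit Arguments.
Unset Strict Implicit.
Unset Printing Implicit Defensive.

Import Order.TTheory GRing.Theory Num.Theory.
Import numFieldNormedType.Exports.

Local Open Scope classical_set_scope.
Local Open Scope ring_scope.

Definition dot (R : realType) (d : nat) (u v : 'cV[R]_d) : R :=
  \sum_i u i 0 * v i 0.

(* Not the norm [`|u|] of the library, which is the max norm on matrices. *)
Definition enorm (R : realType) (d : nat) (u : 'cV[R]_d) : R :=
  Num.sqrt (dot u u).

Definition direction (R : realType) (d : nat) (u : 'cV[R]_d) : 'cV[R]_d :=
  (enorm u)^-1 *: u.

(* A parameter vector is a function [I -> R], where the finite type [I] indexes
   the scalar trainable weights. *)

Definition exp_loss (R : realType) (I J : finType) (d : nat)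
    (P : (I -> R) -> 'cV[R]_d) (x : J -> 'cV[R]_d) (y : J -> R)
    (W : I -> R) : R :=
  \sum_(j : J) expR (- (y j * dot (x j) (P W))).

Definition partial (R : realType) (I : finType) (F : (I -> R) -> R)
    (W : I -> R) (i : I) : R :=
  derive1 (fun s : R => F (@dfwith I (fun=> R) W i s)) (W i).

(* W solves dW/dt = - grad F (W) on [0, +oo[. The equation is only required
   for t > 0, together with continuity up to t = 0; when F is C^1 the one-sided
   equation at t = 0 follows. Values W t with t < 0 are irrelevant. *)
Definition gradient_flow (R : realType) (I : finType) (F : (I -> R) -> R)
    (W : R -> I -> R) : Prop :=
  forall i : I,
    {within `[0, +oo[, continuous (fun t : R => W t i)} /\
    (forall t : R, 0 < t ->
       is_derive t (1 : R) (fun s : R => W s i) (- partial F (W t) i)).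

Record linear_rep (R : realType) (gT : finGroupType) := LinearRep {
  rep_space :> vectType R;
  rep_act : gT -> rep_space -> rep_space;
  rep_act_linear : forall g, linear (rep_act g);
  rep_act1 : forall v, rep_act 1%g v = v;
  rep_actM : forall g h v, rep_act (g * h)%g v = rep_act g (rep_act h v)
}.

Record intertwiner (R : realType) (gT : finGroupType) (X Y : linear_rep R gT) :=
  Intertwiner {
    intertwiner_fun :> 'Hom(X, Y);
    intertwinerP : forall g v,
      intertwiner_fun (rep_act g v) = rep_act g (intertwiner_fun v)
  }.

Program Definition trivial_rep (R : realType) (gT : finGroupType) :
    linear_rep R gT :=
  @LinearRep R gT (R^o : vectType R) (fun _ v => v) _ _ _.
Next Obligation. by []. Qed.
Next Obligation. by []. Qed.
Next Obligation. by []. Qed.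

Program Definition regular_rep (R : realType) (gT : finGroupType) (d1 : nat) :
    linear_rep R gT :=
  @LinearRep R gT {ffun gT -> 'cV[R]_d1}
    (fun g v => [ffun h => v (g^-1 * h)%g]) _ _ _.
Next Obligation. by move=> R gT d1 g a u v; apply/ffunP=> h; rewrite !ffunE. Qed.
Next Obligation.
by move=> R gT d1 v; apply/ffunP=> h; rewrite ffunE invg1 mul1g.
Qed.
Next Obligation.
by move=> R gT d1 g h v; apply/ffunP=> k; rewrite !ffunE invMg mulgA.
Qed.

(* [steer_layers R gT m X] is the data of m >= 1 successive steerable layers
   starting at the representation X and ending at the trivial representation:
   the intermediate representations and, for each layer, the fixed finite
   collection of intertwiners. A network with L layers is made of the lifting
   layer and of [L.-1] steerable layers starting at the regular
   representation. *)

Inductive steer_layers (R : realType) (gT : finGroupType) :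
    nat -> linear_rep R gT -> Type :=
| LastLayer (X : linear_rep R gT) (N : nat)
    (psi : 'I_N -> intertwiner X (trivial_rep R gT)) : steer_layers 1 X
| ConsLayer (m : nat) (X Y : linear_rep R gT) (N : nat)
    (psi : 'I_N -> intertwiner X Y) (tl : steer_layers m Y) :
    steer_layers m.+1 X.

Fixpoint layers_idx (R : realType) (gT : finGroupType) (m : nat)
    (X : linear_rep R gT) (T : steer_layers m X) : finType :=
  match T with
  | LastLayer _ N _ => 'I_N
  | ConsLayer _ _ _ N _ tl => ('I_N + layers_idx tl)%type
  end.

Fixpoint layers_fun (R : realType) (gT : finGroupType) (m : nat)
    (X : linear_rep R gT) (T : steer_layers m X) :
    (layers_idx T -> R) -> X -> R :=
  match T in steer_layers _ X0 return (layers_idx T -> R) -> X0 -> R with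
  | LastLayer _ N psi => fun w v => \sum_(j < N) w j *: psi j v
  | ConsLayer _ _ _ N psi tl => fun w v =>
      layers_fun (fun i => w (inr i)) (\sum_(j < N) w (inl j) *: psi j v)
  end.

(* [mx_representation] only says that rho0 is a morphism into matrices; here
   matrices act on column vectors by left multiplication. *)
Definition lifting (R : realType) (gT : finGroupType) (d0 d1 : nat)
    (rho0 : mx_representation R [set: gT]%SET d0) (w1 : 'M[R]_(d0, d1))
    (x : 'cV[R]_d0) : {ffun gT -> 'cV[R]_d1} :=
  [ffun g => w1^T *m invmx (rho0 g) *m x].

Definition steer_idx (R : realType) (gT : finGroupType) (d0 d1 m : nat)
    (T : steer_layers m (regular_rep R gT d1)) : finType :=
  ('I_d0 * 'I_d1 + layers_idx T)%type.

Definition f_steer (R : realType) (gT : finGroupType) (d0 d1 m : nat)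
    (rho0 : mx_representation R [set: gT]%SET d0)
    (T : steer_layers m (regular_rep R gT d1))
    (W : steer_idx d0 T -> R) (x : 'cV[R]_d0) : R :=
  layers_fun (fun i => W (inr i))
    (lifting rho0 (\matrix_(i, j) W (inl (i, j))) x).

(* The vector representing the linear form [f_steer rho0 W], see
   [f_steer_dot] and [P_steer_unique]. *)
Definition P_steer (R : realType) (gT : finGroupType) (d0 d1 m : nat)
    (rho0 : mx_representation R [set: gT]%SET d0)
    (T : steer_layers m (regular_rep R gT d1))
    (W : steer_idx d0 T -> R) : 'cV[R]_d0 :=
  \col_i f_steer rho0 W (delta_mx i 0).

Lemma layers_fun_linear (R : realType) (gT : finGroupType) (m : nat)
    (X : linear_rep R gT) (T : steer_layers m X) (w : layers_idx T -> R)
    (a : R) (u v : X) :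
  layers_fun w (a *: u + v) = a * layers_fun w u + layers_fun w v.
Proof.
elim: T w a u v => [{}X N psi|{}m {}X Y N psi tl IH] w a u v /=.
- rewrite mulr_sumr -big_split; apply: eq_bigr => j _ /=.
  by rewrite linearP /= scalerDr !scalerA mulrC -scalerA.
- rewrite -IH; congr layers_fun.
  rewrite scaler_sumr -big_split; apply: eq_bigr => j _ /=.
  by rewrite linearP /= scalerDr !scalerA mulrC.
Qed.

Lemma f_steer_linear (R : realType) (gT : finGroupType) (d0 d1 m : nat)
    (rho0 : mx_representation R [set: gT]%SET d0)
    (T : steer_layers m (regular_rep R gT d1)) (W : steer_idx d0 T -> R)
    (a : R) (u v : 'cV[R]_d0) :
  f_steer rho0 W (a *: u + v) = a * f_steer rho0 W u + f_steer rho0 W v.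
Proof.
rewrite /f_steer -layers_fun_linear; congr layers_fun.
by apply/ffunP=> g; rewrite !ffunE mulmxDr -scalemxAr.
Qed.

Lemma f_steer_dot (R : realType) (gT : finGroupType) (d0 d1 m : nat)
    (rho0 : mx_representation R [set: gT]%SET d0)
    (T : steer_layers m (regular_rep R gT d1)) (W : steer_idx d0 T -> R)
    (x : 'cV[R]_d0) :
  f_steer rho0 W x = dot x (P_steer rho0 W).
Proof.
have f0 : f_steer rho0 W 0 = 0.
  have := f_steer_linear rho0 W (-1) 0 0.
  by rewrite scaler0 addr0 mulN1r addNr.
have {1}-> : x = \sum_i x i 0 *: delta_mx i 0.
  by rewrite {1}(matrix_sum_delta x); apply: eq_bigr => i _; rewrite big_ord1.
rewrite /dot.
have -> : \sum_i x i 0 * P_steer rho0 W i 0 =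
          \sum_i x i 0 * f_steer rho0 W (delta_mx i 0).
  by apply: eq_bigr => i _; rewrite mxE.
elim/big_rec2: _ => [//|i u v _ <-].
by rewrite f_steer_linear.
Qed.

Lemma P_steer_unique (R : realType) (gT : finGroupType) (d0 d1 m : nat)
    (rho0 : mx_representation R [set: gT]%SET d0)
    (T : steer_layers m (regular_rep R gT d1)) (W : steer_idx d0 T -> R)
    (b : 'cV[R]_d0) :
  (forall x, f_steer rho0 W x = dot x b) -> b = P_steer rho0 W.
Proof.
move=> hb; apply/colP=> i; rewrite mxE hb /dot (bigD1 i) //= mxE !eqxx mul1r.
by rewrite big1 ?addr0// => j /negbTE ji; rewrite mxE ji mul0r.
Qed.

(* [k] is the input width and [ks] lists the hidden widths k_1, ..., k_{L-1},
   so that the number of layers is L = (size ks).+1. *)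

Fixpoint fc_idx (k : nat) (ks : seq nat) : finType :=
  match ks with
  | [::] => 'I_k
  | k' :: ks' => ('I_k * 'I_k' + fc_idx k' ks')%type
  end.

Fixpoint P_fc (R : realType) (k : nat) (ks : seq nat) :
    (fc_idx k ks -> R) -> 'cV[R]_k :=
  match ks return (fc_idx k ks -> R) -> 'cV[R]_k with
  | [::] => fun W => \col_i W i
  | k' :: ks' => fun W =>
      (\matrix_(i < k, j < k') W (inl (i, j))) *m
        P_fc (fun i : fc_idx k' ks' => W (inr i))
  end.

Definition aug_x (R : realType) (gT : finGroupType) (d0 n : nat)
    (rho0 : mx_representation R [set: gT]%SET d0) (x : 'I_n -> 'cV[R]_d0)
    (ig : 'I_n * gT) : 'cV[R]_d0 :=
  rho0 ig.2 *m x ig.1.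

Definition aug_y (R : realType) (gT : finGroupType) (n : nat) (y : 'I_n -> R)
    (ig : 'I_n * gT) : R :=
  y ig.1.

(* Main.v *)
(** Averaging over the group writes the steerable predictor as [A w1 M(w')]
    with [A] the orthogonal projection onto the invariant vectors, [w1] the
    first layer and [M] a homogeneous polynomial of the later weights; the
    fully-connected predictor has the same shape with [A = 1].

    For such a network the normalized margin [- ln F / |W|^k], where [F] is the
    loss and [k] the depth, cannot decrease once [F < 1], and being bounded it
    forces [W] to be almost aligned with [- grad F] at arbitrarily late times
    (Lyu and Li). The first-layer component of this alignment says that the
    predictor is almost proportional to a combination of the vectors [A z_j],
    [z_j = y_j x_j], with weights [exp (- z_j . P W)], which concentrate on the
    support vectors. Hence the limit direction [b] satisfies
    [m <= (u . b) (z_j . b)] for all [j] whenever [0 <= m <= z_i . A u] for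
    all [i].

    Apply this to each of the two networks with [u] the limit of the other one:
    if [s] and [f] are their smallest margins and [c] is the inner product of
    the two limits, then [f <= c s] and [s <= c f], so [1 <= c], and the two
    vectors of norm at most 1 are equal. *)

Require Import Defs.
From HB Require Import structures.
From mathcomp Require Import all_boot all_order all_algebra all_fingroup.
From mathcomp Require Import mxrepresentation.
From mathcomp Require Import all_classical all_reals all_analysis.
From mathcomp Require Import ring lra.

Set Implicit Arguments.
Unset Strict Implicit.
Unset Printing Implicit Defensive.

Import Order.TTheory GRing.Theory Num.Theory.
Import numFieldNormedType.Exports.

Local Open Scope classical_set_scope.
Local Open Scope ring_scope.

(** * Derivatives and gradients along curves *)

Lemma ler_is_derive (R : realType) (f df : R -> R) (a b : R) : a <= b ->
  (forall t, a <= t -> is_derive t (1 : R) f (df t)) ->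
  (forall t, a <= t -> 0 <= df t) -> f a <= f b.
Proof.
move=> ab fdf df_ge0; rewrite -subr_ge0.
have [//| |c] := @MVT_segment R f df a b ab.
- by move=> t; rewrite in_itv => /andP[/ltW/fdf].
- apply: derivable_within_continuous => t.
  by rewrite in_itv => /andP[/fdf].
- rewrite in_itv => /andP[/df_ge0 ? _] ->.
  by rewrite mulr_ge0 ?subr_ge0.
Qed.

Lemma is_derive_bigsum (R : realType) (I : Type) (r : seq I)
    (f : I -> R -> R) (df : I -> R) (t : R) :
  (forall i, is_derive t (1 : R) (f i) (df i)) ->
  is_derive t (1 : R) (fun s => \sum_(i <- r) f i s) (\sum_(i <- r) df i).
Proof.
move=> fdf; elim: r => [|i r IH].
  rewrite big_nil; apply: is_derive_eq; last by [].
  have -> : (fun s => \sum_(i <- [::]) f i s) = cst 0.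
    by apply/funext => s; rewrite big_nil.
  exact: is_derive_cst.
have -> : (fun s => \sum_(i <- i :: r) f i s) =
    f i + (fun s => \sum_(i <- r) f i s).
  by apply/funext => s; rewrite big_cons.
by rewrite big_cons; exact: is_deriveD.
Qed.

(** Differentiability is encoded as the chain rule along every curve with differentiable
    coordinates. This form passes through sums, products and [expR], and it is what a gradient flow
    calls for. *)
Definition has_gradient (R : realType) (I : finType)
    (H : (I -> R) -> R) (D : (I -> R) -> I -> R) : Prop :=
  forall (c : R -> I -> R) (c' : I -> R) (t : R),
    (forall i, is_derive t (1 : R) (fun s => c s i) (c' i)) ->
    is_derive t (1 : R) (fun s => H (c s)) (\sum_i D (c t) i * c' i).

Lemma is_derive_dfwith (R : realType) (I : finType) (W : I -> R) (i k : I)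
    (t : R) :
  is_derive t (1 : R) (fun s => @dfwith I (fun=> R) W i s k) (k == i)%:R.
Proof.
have [->|ki] := eqVneq k i.
  have -> : (fun s => @dfwith I (fun=> R) W i s i) = id.
    by apply/funext => s; rewrite dfwithin.
  exact: is_derive_id.
have -> : (fun s => @dfwith I (fun=> R) W i s k) = cst (W k).
  by apply/funext => s; rewrite dfwithout// eq_sym.
exact: is_derive_cst.
Qed.

Lemma dfwith_id (R : realType) (I : finType) (W : I -> R) (i : I) :
  @dfwith I (fun=> R) W i (W i) = W.
Proof.
apply/funext => k; have [->|ki] := eqVneq k i; first by rewrite dfwithin.
by rewrite dfwithout// eq_sym.
Qed.

Lemma has_gradient_partial (R : realType) (I : finType)
    (H : (I -> R) -> R) D (W : I -> R) i :
  has_gradient H D -> partial H W i = D W i.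
Proof.
move=> HD; rewrite /partial derive1E.
have := HD _ _ (W i) (fun k => is_derive_dfwith W i k (W i)).
move=> /@derive_val ->; rewrite dfwith_id (bigD1 i) //= eqxx mulr1.
by rewrite big1 ?addr0// => k /negbTE ->; rewrite mulr0.
Qed.

Lemma has_gradient_is_derive (R : realType) (I : finType)
    (H : (I -> R) -> R) (c : R -> I -> R) (c' : I -> R) (t : R) :
  (exists D, has_gradient H D) ->
  (forall i, is_derive t (1 : R) (fun s => c s i) (c' i)) ->
  is_derive t (1 : R) (fun s => H (c s)) (\sum_i partial H (c t) i * c' i).
Proof.
move=> [D HD] cc'; apply: is_derive_eq; first exact: HD cc'.
by apply: eq_bigr => i _; rewrite (has_gradient_partial _ _ HD).
Qed.

(** * Homogeneous polynomial functions of the weights *)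

Inductive form (R : realType) (I : finType) : nat -> ((I -> R) -> R) -> Prop :=
| form_zero k : form k (fun=> 0)
| form_const a : form 0 (fun=> a)
| form_coord i : form 1 (fun W => W i)
| form_add k H1 H2 : form k H1 -> form k H2 -> form k (fun W => H1 W + H2 W)
| form_mul k1 k2 H1 H2 : form k1 H1 -> form k2 H2 ->
    form (k1 + k2) (fun W => H1 W * H2 W).

Lemma form_sum (R : realType) (I : finType) (J : Type) (r : seq J) k
    (H : J -> (I -> R) -> R) :
  (forall j, form k (H j)) -> form k (fun W => \sum_(j <- r) H j W).
Proof.
move=> Hk; elim: r => [|j r IH].
  have -> : (fun W => \sum_(j <- [::]) H j W) = fun=> 0.
    by apply/funext => W; rewrite big_nil.
  exact: form_zero.
have -> : (fun W => \sum_(j <- j :: r) H j W) =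
    fun W => H j W + \sum_(j <- r) H j W.
  by apply/funext => W; rewrite big_cons.
exact: form_add.
Qed.

Lemma form_scale (R : realType) (I : finType) k a (H : (I -> R) -> R) :
  form k H -> form k (fun W => a * H W).
Proof. by move=> Hk; rewrite -[k]add0n; apply: form_mul; first exact: form_const. Qed.

Lemma form_reindex (R : realType) (I I' : finType) k (H : (I -> R) -> R)
    (f : I -> I') : form k H -> form k (fun W => H (W \o f)).
Proof.
elim=> {k H} [k|a|i|k H1 H2 _ h1 _ h2|k1 k2 H1 H2 _ h1 _ h2].
- exact: form_zero.
- exact: form_const.
- exact: form_coord.
- exact: form_add.
- exact: form_mul.
Qed.

Lemma form_homogeneous (R : realType) (I : finType) k (H : (I -> R) -> R) W s :
  form k H -> H (fun i => s * W i) = s ^+ k * H W.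
Proof.
elim=> {k H} [k|a|i|k H1 H2 _ h1 _ h2|k1 k2 H1 H2 _ h1 _ h2].
- by rewrite mulr0.
- by rewrite mul1r.
- by [].
- by rewrite h1 h2 mulrDr.
- by rewrite h1 h2 exprD mulrACA.
Qed.

Lemma form_bound (R : realType) (I : finType) k (H : (I -> R) -> R) :
  form k H -> exists2 C, 0 <= C & forall W r, 0 <= r ->
    (forall i, `|W i| <= r) -> `|H W| <= C * r ^+ k.
Proof.
elim=> {k H} [k|a|i|k H1 H2 _ [C1 ? h1] _ [C2 ? h2]
  |k1 k2 H1 H2 _ [C1 ? h1] _ [C2 ? h2]].
- by exists 0 => // W r _ _; rewrite normr0 mul0r.
- by exists `|a| => // W r _ _; rewrite mulr1.
- by exists 1 => // W r _ Wr; rewrite mul1r expr1.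
- exists (C1 + C2); rewrite ?addr_ge0// => W r r0 Wr.
  by rewrite (le_trans (ler_normD _ _))// mulrDl lerD// ?h1// h2.
- exists (C1 * C2); rewrite ?mulr_ge0// => W r r0 Wr.
  by rewrite normrM exprD mulrACA ler_pM// ?h1// h2.
Qed.

Lemma form_has_gradient (R : realType) (I : finType) k (H : (I -> R) -> R) :
  form k H -> exists D, has_gradient H D.
Proof.
elim=> {k H} [k|a|i|k H1 H2 _ [D1 h1] _ [D2 h2]
  |k1 k2 H1 H2 _ [D1 h1] _ [D2 h2]].
- exists (fun _ _ => 0) => c c' t cc'.
  by rewrite big1 => [|i _]; [exact: is_derive_cst|rewrite mul0r].
- exists (fun _ _ => 0) => c c' t cc'.
  by rewrite big1 => [|i _]; [exact: is_derive_cst|rewrite mul0r].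
- exists (fun _ j => (j == i)%:R) => c c' t cc'.
  rewrite (bigD1 i) //= eqxx mul1r big1 ?addr0// => j /negbTE ->.
  by rewrite mul0r.
- exists (fun W i => D1 W i + D2 W i) => c c' t cc'.
  have -> : \sum_i (D1 (c t) i + D2 (c t) i) * c' i =
      \sum_i D1 (c t) i * c' i + \sum_i D2 (c t) i * c' i.
    by rewrite -big_split; apply: eq_bigr => i _; rewrite mulrDl.
  by apply: is_deriveD; [exact: h1|exact: h2].
- exists (fun W i => H1 W * D2 W i + H2 W * D1 W i) => c c' t cc'.
  have -> : \sum_i (H1 (c t) * D2 (c t) i + H2 (c t) * D1 (c t) i) * c' i =
      H1 (c t) * (\sum_i D2 (c t) i * c' i) + H2 (c t) * \sum_i D1 (c t) i * c' i.
    rewrite !mulr_sumr -big_split; apply: eq_bigr => i _.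
    by rewrite mulrDl !mulrA.
  by apply: is_deriveM; [exact: h1|exact: h2].
Qed.

Lemma sum_expR_has_gradient (R : realType) (I J : finType)
    (q : J -> (I -> R) -> R) :
  (forall j, exists D, has_gradient (q j) D) ->
  exists D, has_gradient (fun W => \sum_j expR (- q j W)) D.
Proof.
move=> /choice[D qD]; exists (fun W i => \sum_j - expR (- q j W) * D j W i).
move=> c c' t cc'.
have -> : \sum_i (\sum_j - expR (- q j (c t)) * D j (c t) i) * c' i =
    \sum_j expR (- q j (c t)) * - \sum_i D j (c t) i * c' i.
  under eq_bigr do rewrite mulr_suml.
  rewrite exchange_big; apply: eq_bigr => j _ /=.
  by rewrite mulrN -mulNr mulr_sumr; apply: eq_bigr => i _; rewrite mulrA.
apply: is_derive_bigsum => j.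
apply: (@is_derive1_comp _ expR (fun s => - q j (c s))).
by apply: is_deriveN; exact: qD.
Qed.

(** * Inner product on the weight space *)

Definition pdot (R : realType) (I : finType) (u v : I -> R) : R :=
  \sum_i u i * v i.

Lemma pdotC (R : realType) (I : finType) (u v : I -> R) : pdot u v = pdot v u.
Proof. by apply: eq_bigr => i _; rewrite mulrC. Qed.

Lemma pdot_ge0 (R : realType) (I : finType) (u : I -> R) : 0 <= pdot u u.
Proof. by apply: sumr_ge0 => i _; rewrite -expr2 sqr_ge0. Qed.

Lemma pdot_comb (R : realType) (I : finType) (u v w : I -> R) a b :
  pdot (fun i => a * u i + b * v i) w = a * pdot u w + b * pdot v w.
Proof.
rewrite /pdot !mulr_sumr -big_split; apply: eq_bigr => i _ /=.
by rewrite mulrDl !mulrA.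
Qed.

Lemma pdot_sqr_comb (R : realType) (I : finType) (u v : I -> R) a b :
  pdot (fun i => a * u i + b * v i) (fun i => a * u i + b * v i) =
  a ^+ 2 * pdot u u + 2 * (a * b) * pdot u v + b ^+ 2 * pdot v v.
Proof.
rewrite pdot_comb !(pdotC _ (fun i => _ + _)) !pdot_comb (pdotC v u).
by ring.
Qed.

Lemma pdot_cauchy_schwarz (R : realType) (I : finType) (u v : I -> R) :
  pdot u v ^+ 2 <= pdot u u * pdot v v.
Proof.
have [v0|v_neq0] := eqVneq (pdot v v) 0.
  have vi i : v i = 0.
    apply/eqP; rewrite -sqrf_eq0 expr2.
    move: v0 => /eqP; rewrite psumr_eq0 => [/allP/(_ i)|j _].
      by rewrite mem_index_enum => /(_ isT).
    by rewrite -expr2 sqr_ge0.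
  by rewrite v0 mulr0 /pdot big1 ?expr0n// => i _; rewrite vi mulr0.
have v_gt0 : 0 < pdot v v by rewrite lt_def v_neq0 pdot_ge0.
have := pdot_ge0 (fun i => pdot v v * u i + - pdot u v * v i).
rewrite pdot_sqr_comb.
rewrite (_ : _ + _ = pdot v v * (pdot u u * pdot v v - pdot u v ^+ 2)); last by ring.
by rewrite pmulr_rge0// subr_ge0.
Qed.

(** * Exponential loss of homogeneous margins *)

Definition sum_exp (R : realType) (I J : finType) (q : J -> (I -> R) -> R)
  (V : I -> R) : R := \sum_j expR (- q j V).

Section ExponentialLoss.
Variables (R : realType) (I J : finType) (k : nat) (q : J -> (I -> R) -> R).
Hypotheses (k_gt0 : (0 < k)%N) (q_form : forall j, form k (q j)) (j0 : J).

Local Notation F := (sum_exp q).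

Lemma loss_has_gradient : exists D, has_gradient F D.
Proof.
by apply: sum_expR_has_gradient => j; exact: form_has_gradient (q_form j).
Qed.

Lemma loss_gt0 V : 0 < F V.
Proof.
rewrite /sum_exp (bigD1 j0)//= ltr_pwDl ?expR_gt0//.
by apply: sumr_ge0 => j _; exact: expR_ge0.
Qed.

(** Each single exponential is at most the loss, so [- ln F] is a smooth substitute for the smallest
    margin. *)
Lemma loss_margin V j : - ln (F V) <= q j V.
Proof.
rewrite lerNl -[X in X <= _]expRK ler_ln ?posrE ?expR_gt0 ?loss_gt0//.
rewrite /sum_exp (bigD1 j)//= lerDl.
by apply: sumr_ge0 => i _; exact: expR_ge0.
Qed.

(** Euler's identity: [F (s V)] is differentiated at [s = 1] once by the chain rule and once by the
    homogeneity of the margins. *)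
Lemma loss_euler V : - pdot (partial F V) V = k%:R * \sum_j expR (- q j V) * q j V.
Proof.
have d1 : is_derive (1 : R) (1 : R) (fun s : R => F (fun i => s * V i))
    (\sum_i partial F (fun i => 1 * V i) i * V i).
  apply: (@has_gradient_is_derive _ _ F (fun s i => s * V i) V);
    first exact: loss_has_gradient.
  move=> i; have -> : (fun s : R => s * V i) = V i \*: id.
    by apply/funext => s /=; rewrite /GRing.scale /= mulrC.
  by apply: is_derive_eq; rewrite /GRing.scale /= mulr1.
have d2 : is_derive (1 : R) (1 : R) (fun s : R => F (fun i => s * V i))
    (\sum_j expR (- (1 ^+ k * q j V)) * - (q j V * k%:R)).
  have -> : (fun s : R => F (fun i => s * V i)) =
      fun s => \sum_j expR (- (s ^+ k * q j V)).
    apply/funext => s; apply: eq_bigr => j _.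
    by rewrite (form_homogeneous _ _ (q_form j)).
  apply: is_derive_bigsum => j.
  apply: (@is_derive1_comp _ expR (fun s => - (s ^+ k * q j V))).
  apply: is_deriveN.
  have -> : (fun s : R => s ^+ k * q j V) = q j V \*: (id ^+ k).
    by apply/funext => s /=; rewrite /GRing.scale /= fctE mulrC.
  apply: is_derive_eq.
  by rewrite /GRing.scale /= expr1n !mulr1.
have := @derive_val _ _ _ _ _ _ _ d1; rewrite (@derive_val _ _ _ _ _ _ _ d2).
have -> : (fun i => 1 * V i) = V by apply/funext => i; rewrite mul1r.
rewrite /pdot => <-; rewrite mulr_sumr -sumrN; apply: eq_bigr => j _.
by rewrite expr1n mul1r; ring.
Qed.

Lemma loss_euler_ge V : k%:R * (F V * - ln (F V)) <= - pdot (partial F V) V.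
Proof.
rewrite loss_euler ler_pM2l ?ltr0n// mulr_suml ler_sum// => j _.
by rewrite ler_pM2l ?expR_gt0// loss_margin.
Qed.

Lemma margin_bound : exists2 C, 0 < C & forall V,
  - ln (F V) <= C * Num.sqrt (pdot V V) ^+ k.
Proof.
have [C C_ge0 HC] := form_bound (q_form j0).
(* The added 1 makes the constant positive, so that its logarithm can be used later. *)
exists (C + 1) => [|V]; first by rewrite ltr_wpDl.
rewrite (le_trans (loss_margin V j0))// (le_trans (ler_norm _))//.
rewrite (@le_trans _ _ (C * Num.sqrt (pdot V V) ^+ k))//.
  apply: HC => // i; rewrite -sqrtr_sqr ler_wsqrtr// /pdot (bigD1 i)//= -expr2.
  by rewrite lerDl sumr_ge0// => i' _; rewrite -expr2 sqr_ge0.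
by rewrite ler_wpM2r ?exprn_ge0// lerDl.
Qed.

(** At the origin, forms of positive degree vanish, which forces [- ln F] to be at most 0. *)
Lemma small_loss_pdot_gt0 V : F V < 1 -> 0 < pdot V V.
Proof.
move=> F_lt1; rewrite lt_def pdot_ge0 andbT; apply/eqP => V0.
have [C _ /(_ V)] := margin_bound.
rewrite V0 sqrtr0 expr0n gtn_eqF// mulr0 lerNl oppr0 leNgt.
by rewrite -ln1 ltr_ln ?posrE ?loss_gt0// F_lt1.
Qed.

(** * Gradient flow once the loss is below 1 *)

Variables (W : R -> I -> R) (t0 : R).
Hypotheses (flow : gradient_flow F W) (t0_gt0 : 0 < t0) (loss_t0 : F (W t0) < 1).

(** [nu] is half the derivative of the squared norm [S], and [ll] is the smooth lower bound for all
    margins. *)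
Local Notation S t := (pdot (W t) (W t)).
Local Notation G t := (partial F (W t)).
Local Notation nu t := (- pdot (G t) (W t)).
Local Notation ll t := (- ln (F (W t))).

Let derive_loss t : t0 <= t ->
  is_derive t (1 : R) (fun s => - F (W s)) (pdot (G t) (G t)).
Proof.
move=> t0t; have t_gt0 : 0 < t by exact: lt_le_trans t0t.
have dF := has_gradient_is_derive loss_has_gradient (fun i => (flow i).2 t t_gt0).
refine (is_derive_eq (is_deriveN dF) _).
by rewrite -sumrN; apply: eq_bigr => i _; rewrite mulrN opprK.
Qed.

Let derive_norm t : t0 <= t -> is_derive t (1 : R) (fun s => S s) (2 * nu t).
Proof.
move=> t0t; have t_gt0 : 0 < t by exact: lt_le_trans t0t.
have -> : 2 * nu t = \sum_i (W t i * - G t i + W t i * - G t i).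
  rewrite /pdot -sumrN mulr_sumr; apply: eq_bigr => i _.
  by ring.
apply: is_derive_bigsum => i.
by apply: is_deriveM; exact: (flow i).2.
Qed.

Lemma flow_loss_lt1 t : t0 <= t -> F (W t) < 1.
Proof.
move=> t0t; apply: le_lt_trans loss_t0.
rewrite -lerN2; apply: (ler_is_derive t0t derive_loss) => s _.
exact: pdot_ge0.
Qed.

Let S_gt0 t : t0 <= t -> 0 < S t.
Proof. by move=> /flow_loss_lt1/small_loss_pdot_gt0. Qed.

Let ll_gt0 t : t0 <= t -> 0 < ll t.
Proof.
move=> t0t; rewrite oppr_gt0 -ln1 ltr_ln ?posrE ?loss_gt0//.
exact: flow_loss_lt1.
Qed.

Lemma flow_radial_gt0 t : t0 <= t -> 0 < nu t.
Proof.
move=> t0t; apply: lt_le_trans (loss_euler_ge (W t)).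
by rewrite mulr_gt0 ?ltr0n// mulr_gt0 ?loss_gt0// ll_gt0.
Qed.

Let derive_ll t : t0 <= t ->
  is_derive t (1 : R) (fun s => ll s) ((F (W t))^-1 * pdot (G t) (G t)).
Proof.
move=> t0t.
have dF : is_derive t (1 : R) (fun s => F (W s)) (- pdot (G t) (G t)).
  have -> : (fun s => F (W s)) = - (fun s => - F (W s)).
    by apply/funext => s; rewrite fctE opprK.
  by have := derive_loss t0t => ?; exact: is_deriveN.
have dln := is_derive1_comp (is_derive1_ln (loss_gt0 (W t))) dF.
by refine (is_derive_eq (is_deriveN dln) _); rewrite mulrN opprK.
Qed.

(* The derivative of [ln ll - (1 + e) k / 2 ln S] is nonnegative because
   [nu >= k F ll]. For [e = 0] the assumption is the Cauchy-Schwarz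
   inequality. *)
Lemma flow_growth e t1 t : 0 <= e -> t0 <= t1 -> t1 <= t ->
  (forall s, t1 <= s -> (1 + e) * nu s ^+ 2 <= pdot (G s) (G s) * S s) ->
  ln (ll t1) - (1 + e) * (k%:R / 2) * ln (S t1) <=
  ln (ll t) - (1 + e) * (k%:R / 2) * ln (S t).
Proof.
move=> e_ge0 t01 t1t He; set c := (1 + e) * (k%:R / 2).
apply: (@ler_is_derive _ (fun s => ln (ll s) - c * ln (S s))
  (fun s => (ll s)^-1 * ((F (W s))^-1 * pdot (G s) (G s)) -
            c * ((S s)^-1 * (2 * nu s)))) => // s t1s;
  have t0s := le_trans t01 t1s.
  apply: is_deriveB.
    by apply: is_derive1_comp; [exact: is_derive1_ln (ll_gt0 t0s)|exact: derive_ll].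
  apply: is_deriveZ; apply: is_derive1_comp; last exact: derive_norm.
  exact: is_derive1_ln (S_gt0 t0s).
have S0 := S_gt0 t0s; have l0 := ll_gt0 t0s; have n0 := flow_radial_gt0 t0s.
have F0 := loss_gt0 (W s); rewrite subr_ge0.
set l := ll s in l0 *; set m := nu s in n0 *.
have -> : c * ((S s)^-1 * (2 * m)) = (1 + e) * k%:R * m / S s.
  by rewrite /c; field; rewrite gt_eqF.
rewrite ler_pdivrMr//.
have -> : l^-1 * ((F (W s))^-1 * pdot (G s) (G s)) * S s =
    pdot (G s) (G s) * S s / (F (W s) * l).
  by field; rewrite !gt_eqF.
rewrite ler_pdivlMr ?mulr_gt0//; apply: le_trans (He _ t1s).
rewrite -!mulrA ler_wpM2l ?addr_ge0// expr2.
by rewrite mulrCA ler_wpM2l ?(ltW n0)//; exact: loss_euler_ge.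
Qed.

Lemma ln_sqrtX (x : R) : 0 < x -> ln (Num.sqrt x ^+ k) = k%:R / 2 * ln x.
Proof.
move=> x0; rewrite -{2}(sqr_sqrtr (ltW x0)) !lnXn ?sqrtr_gt0//.
by rewrite -[_ *+ k]mulr_natl -[_ *+ 2]mulr_natl; field.
Qed.

(** The ratio of [ll] to the [k]-th power of the norm of [W] never decreases, by [flow_growth] with
    [e = 0]. Its value at [t0] serves as the constant. *)
Lemma flow_margin : exists2 c, 0 < c & forall t, t0 <= t -> forall j,
  c * Num.sqrt (S t) ^+ k <= q j (W t).
Proof.
exists (expR (ln (ll t0) - k%:R / 2 * ln (S t0))) => [|t t0t j].
  exact: expR_gt0.
apply: le_trans (loss_margin (W t) j).
have S0 := S_gt0 t0t.
rewrite -[X in _ * X]lnK ?posrE ?exprn_gt0 ?sqrtr_gt0// -expRD.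
rewrite -[X in _ <= X]lnK ?posrE; last exact: ll_gt0.
rewrite ler_expR ln_sqrtX// -lerBrDr.
have cs s : t0 <= s -> (1 + 0) * nu s ^+ 2 <= pdot (G s) (G s) * S s.
  by move=> _; rewrite addr0 mul1r sqrrN; exact: pdot_cauchy_schwarz.
by have := flow_growth (lexx 0) (lexx t0) t0t cs; rewrite addr0 !mul1r.
Qed.

Let S_homo s t : t0 <= s -> s <= t -> S s <= S t.
Proof.
move=> t0s st.
apply: (@ler_is_derive _ (fun r => S r) (fun r => 2 * nu r)) => // r sr.
  by apply: derive_norm; exact: le_trans sr.
by rewrite mulr_ge0// ltW// flow_radial_gt0// (le_trans t0s).
Qed.

Let ll_homo t : t0 <= t -> ll t0 <= ll t.
Proof.
move=> t0t; apply: (@ler_is_derive _ (fun r => ll r)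
  (fun r => (F (W r))^-1 * pdot (G r) (G r))) => // r _.
by rewrite mulr_ge0 ?invr_ge0 ?pdot_ge0// ltW// loss_gt0.
Qed.

(** If [S] stayed below [B], the loss would stay away from 0, hence so would [nu], and [S] would
    grow at least linearly past [B]. *)
Lemma flow_norm_unbounded B : exists2 t1, t0 <= t1 & forall t, t1 <= t -> B <= S t.
Proof.
have [//|nB] := pselect (exists2 t1, t0 <= t1 & forall t, t1 <= t -> B <= S t).
have SB t : t0 <= t -> S t < B.
  move=> t0t; rewrite ltNge; apply/negP => BS; apply: nB.
  by exists t => // s ts; exact: le_trans (S_homo t0t ts).
have [C C0 HC] := margin_bound.
(* While [S] is below [B], [M] bounds [ll] from above, and [d] bounds the derivative of [S] from
   below. Over a time [B / d] the growth of [S] is then at least [B]. *)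
pose M := C * Num.sqrt B ^+ k.
pose d := 2 * (k%:R * (expR (- M) * ll t0)).
have d0 : 0 < d by rewrite !mulr_gt0 ?ltr0n ?expR_gt0// ll_gt0.
have B0 : 0 < B by apply: lt_trans (SB t0 (lexx _)); exact: S_gt0.
have t0t : t0 <= t0 + B / d by rewrite lerDl divr_ge0 ?ltW.
have : S t0 - d * t0 <= S (t0 + B / d) - d * (t0 + B / d).
  apply: (@ler_is_derive _ (fun s => S s - d * s) (fun s => 2 * nu s - d)) => //.
    move=> s t0s; apply: is_deriveB; first exact: derive_norm.
    refine (is_derive_eq (is_deriveZ d (is_derive_id s (1 : R))) _).
    by rewrite /GRing.scale /= mulr1.
  move=> s t0s; rewrite subr_ge0 /d ler_pM2l//; apply: le_trans (loss_euler_ge (W s)).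
  rewrite ler_pM2l ?ltr0n// ler_pM ?expR_ge0 ?(ltW (ll_gt0 _)) ?ll_homo//.
  rewrite -[X in _ <= X]lnK ?posrE ?loss_gt0// ler_expR lerNl.
  apply: le_trans (HC _) _.
  rewrite ler_wpM2l ?(ltW C0)// lerXn2r ?nnegrE ?sqrtr_ge0//.
  by rewrite ler_wsqrtr// ltW// SB.
have -> : d * (t0 + B / d) = d * t0 + B by field; rewrite gt_eqF.
have := SB _ t0t; have := S_gt0 (lexx t0); lra.
Qed.

(* Lyu and Li: were the angle between [W] and the gradient bounded away from
   zero, [ll] would grow faster than the [k]-th power of the norm of [W]. *)
Lemma flow_alignment e t1 : 0 < e -> exists t, [/\ t0 <= t, t1 <= t &
  pdot (G t) (G t) * S t < (1 + e) * nu t ^+ 2].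
Proof.
move=> e0; have [//|ne] := pselect (exists t, [/\ t0 <= t, t1 <= t &
  pdot (G t) (G t) * S t < (1 + e) * nu t ^+ 2]).
pose t2 := Num.max t0 t1.
have t02 : t0 <= t2 by rewrite le_max lexx.
have He s : t2 <= s -> (1 + e) * nu s ^+ 2 <= pdot (G s) (G s) * S s.
  move=> t2s; rewrite leNgt; apply/negP => lte; apply: ne; exists s.
  by split=> //; move: t2s; rewrite ge_max => /andP[].
have [C C0 HC] := margin_bound.
pose K := ln (ll t2) - (1 + e) * (k%:R / 2) * ln (S t2).
pose a := e * (k%:R / 2).
have a0 : 0 < a by rewrite !mulr_gt0 ?ltr0n ?invr_gt0.
(* The growth inequality and [margin_bound] together give [a * ln (S t) <= ln C - K], which fails as
   soon as [ln (S t)] reaches [b]. *)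
pose b := (ln C - K) / a + 1.
have [t3 t03 Ht3] := flow_norm_unbounded (expR b).
pose t := Num.max t2 t3.
have t2t : t2 <= t by rewrite le_max lexx.
have t0t : t0 <= t := le_trans t02 t2t.
have S0 := S_gt0 t0t.
have := flow_growth (ltW e0) t02 t2t He; rewrite -/K.
have : ln (ll t) <= ln C + k%:R / 2 * ln (S t).
  rewrite -ln_sqrtX// -lnM ?posrE ?exprn_gt0 ?sqrtr_gt0//.
  by rewrite ler_ln ?posrE ?HC ?mulr_gt0 ?exprn_gt0 ?sqrtr_gt0// ll_gt0.
have : b <= ln (S t).
  by rewrite -[b]expRK ler_ln ?posrE ?expR_gt0// Ht3// le_max lexx orbT.
rewrite -(ler_pM2l a0) /b mulrDr mulrCA divff ?gt_eqF// !mulr1 mulrDl mul1r mulrDl -/a.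
lra.
Qed.

End ExponentialLoss.

(** * Euclidean geometry of predictors and limits at infinity *)

Lemma dotE (R : realType) (d : nat) (u v : 'cV[R]_d) : dot u v = (u^T *m v) 0 0.
Proof. by rewrite mxE; apply: eq_bigr => i _; rewrite mxE. Qed.

Lemma dotC (R : realType) (d : nat) (u v : 'cV[R]_d) : dot u v = dot v u.
Proof. exact: pdotC. Qed.

Lemma dotDr (R : realType) (d : nat) (u v w : 'cV[R]_d) :
  dot u (v + w) = dot u v + dot u w.
Proof. by rewrite !dotE mulmxDr mxE. Qed.

Lemma dotZr (R : realType) (d : nat) a (u v : 'cV[R]_d) :
  dot u (a *: v) = a * dot u v.
Proof. by rewrite !dotE -scalemxAr mxE. Qed.

Lemma dotZl (R : realType) (d : nat) a (u v : 'cV[R]_d) :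
  dot (a *: u) v = a * dot u v.
Proof. by rewrite dotC dotZr dotC. Qed.

Lemma dot_mulmx (R : realType) (m n : nat) (B : 'M[R]_(m, n)) u v :
  dot u (B *m v) = dot (B^T *m u) v.
Proof. by rewrite !dotE trmx_mul trmxK mulmxA. Qed.

Lemma dot_ge0 (R : realType) (d : nat) (u : 'cV[R]_d) : 0 <= dot u u.
Proof. exact: pdot_ge0. Qed.

Lemma dot_cauchy_schwarz (R : realType) (d : nat) (u v : 'cV[R]_d) :
  dot u v ^+ 2 <= dot u u * dot v v.
Proof. exact: pdot_cauchy_schwarz. Qed.

Lemma dot_cvg (R : realType) (d : nat) (f g : R -> 'cV[R]_d) (a b : 'cV[R]_d) :
  f t @[t --> +oo] --> a -> g t @[t --> +oo] --> b ->
  dot (f t) (g t) @[t --> +oo] --> dot a b.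
Proof.
move=> fa gb; apply: cvg_big => [|i _]; first exact: add_continuous.
apply: cvgM.
- exact: (cvg_comp _ _ fa (@coord_continuous _ _ _ i 0 a)).
- exact: (cvg_comp _ _ gb (@coord_continuous _ _ _ i 0 b)).
Qed.

(** A bound at arbitrarily late times is enough for the limit, and alignment with the gradient is
    known only at such times. *)
Lemma cvg_pinfty_ge (R : realType) (h : R -> R) (a l : R) :
  h t @[t --> +oo] --> l -> (forall t1, exists2 t, t1 <= t & a <= h t) -> a <= l.
Proof.
move=> hl ha; rewrite leNgt; apply/negP => la.
have [M [_ HM]] := cvgr_lt _ hl _ la.
have [t Mt] := ha (M + 1).
by rewrite leNgt HM// (lt_le_trans _ Mt)// ltrDl.
Qed.

Lemma mul_expRN_le1 (R : realType) (s : R) : expR (- s) * s <= 1.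
Proof.
rewrite expRN mulrC ler_pdivrMr ?expR_gt0// mul1r.
by apply: le_trans (expR_ge1Dx s); rewrite lerDr.
Qed.

(** The exponential weights concentrate on small margins: their average margin exceeds any single
    one by at most [#|J|]. With [s = q i V - q j V], each term reduces to the bound
    [expR (- s) * s <= 1]. *)
Lemma sum_exp_margin (R : realType) (I J : finType) (q : J -> (I -> R) -> R) V j :
  \sum_i expR (- q i V) * q i V <= (q j V + #|J|%:R) * sum_exp q V.
Proof.
have Fj : expR (- q j V) <= sum_exp q V.
  rewrite /sum_exp (bigD1 j)//= lerDl.
  by apply: sumr_ge0 => i _; exact: expR_ge0.
rewrite mulrDl -lerBlDl [q j V * _]mulr_sumr -sumrB.
apply: (@le_trans _ _ (\sum_(i : J) expR (- q j V))); last first.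
  by rewrite sumr_const -[leLHS]mulr_natl ler_wpM2l.
apply: ler_sum => i _.
have -> : expR (- q i V) * q i V - q j V * expR (- q i V) =
    expR (- q j V) * (expR (- (q i V - q j V)) * (q i V - q j V)).
  rewrite mulrA -expRD (_ : - q j V - _ = - q i V); last by ring.
  by ring.
by rewrite -[leRHS]mulr1 ler_wpM2l ?expR_ge0// mul_expRN_le1.
Qed.

Lemma ler_norm_sqr (R : realType) (a b : R) : 0 <= b -> a ^+ 2 <= b ^+ 2 -> `|a| <= b.
Proof.
move=> b0 ab; rewrite -sqrtr_sqr -(ger0_norm b0) -(sqrtr_sqr b).
exact: ler_wsqrtr.
Qed.

Lemma enorm_ge0 (R : realType) (d : nat) (u : 'cV[R]_d) : 0 <= enorm u.
Proof. exact: sqrtr_ge0. Qed.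

Lemma enorm_sqr (R : realType) (d : nat) (u : 'cV[R]_d) :
  enorm u ^+ 2 = dot u u.
Proof. by rewrite sqr_sqrtr// dot_ge0. Qed.

Lemma dot_le0_eq0 (R : realType) (d : nat) (u : 'cV[R]_d) : dot u u <= 0 -> u = 0.
Proof.
move=> u_le0; have /eqP : dot u u = 0 by apply/le_anti; rewrite u_le0 dot_ge0.
rewrite psumr_eq0 => [/allP u0|i _]; last by rewrite -expr2 sqr_ge0.
apply/colP => i; have := u0 i; rewrite mem_index_enum => /(_ isT).
by rewrite mxE -expr2 sqrf_eq0 => /eqP.
Qed.

Lemma dot_direction_le1 (R : realType) (d : nat) (u : 'cV[R]_d) :
  dot (direction u) (direction u) <= 1.
Proof.
rewrite dotZl dotZr mulrA -enorm_sqr -expr2 -exprMn.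
have [->|u0] := eqVneq (enorm u) 0; first by rewrite mulr0 expr0n.
by rewrite mulVf// expr1n.
Qed.

(** * Limit direction of the predictor under gradient flow *)

Section FlowDirection.
Variables (R : realType) (I J : finType) (d N : nat).
Variables (P : (I -> R) -> 'cV[R]_d) (A : 'M[R]_d) (z : J -> 'cV[R]_d) (j0 : J).
(** [D u V] is a direction in weight space along which the predictor moves exactly, not only to
    first order, along [A *m u] at rate [kappa V]. In the application it changes the first layer
    alone. *)
Variables (kappa : (I -> R) -> R) (D : 'cV[R]_d -> (I -> R) -> I -> R) (K : R).
Hypothesis P_form : forall i, form N.+1 (fun V => P V i 0).
Hypothesis AP : forall V, A *m P V = P V.
Hypothesis K_ge0 : 0 <= K.
Hypothesis kappa_ge0 : forall V, 0 <= kappa V.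
Hypothesis PD : forall u V s,
  P (fun i => V i + s * D u V i) = P V + (s * kappa V) *: (A *m u).
Hypothesis VD : forall u V, pdot V (D u V) = dot u (P V).
Hypothesis DD : forall u V, pdot (D u V) (D u V) <= K * dot u u * pdot V V ^+ N.

Let q (j : J) (V : I -> R) : R := dot (z j) (P V).

Let q_form j : form N.+1 (q j).
Proof. by apply: form_sum => i; exact: form_scale. Qed.

(** The chain rule and the exact formula [PD] compute the same derivative at [s = 0]. *)
Lemma loss_directional_derivative u V :
  - pdot (partial (sum_exp q) V) (D u V) =
  kappa V * \sum_j expR (- q j V) * dot (z j) (A *m u).
Proof.
have d1 : is_derive (0 : R) (1 : R)
    (fun s : R => sum_exp q (fun i => V i + s * D u V i))
    (\sum_i partial (sum_exp q) (fun i => V i + 0 * D u V i) i * D u V i).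
  apply: (@has_gradient_is_derive _ _ (sum_exp q)
    (fun s i => V i + s * D u V i) (D u V)).
    exact: (loss_has_gradient q_form).
  move=> i; have -> : (fun s : R => V i + s * D u V i) =
      cst (V i) + D u V i \*: id.
    by apply/funext => s /=; rewrite fctE /= /GRing.scale /= mulrC.
  by apply: is_derive_eq; rewrite /GRing.scale /= mulr1 add0r.
have d2 : is_derive (0 : R) (1 : R)
    (fun s : R => sum_exp q (fun i => V i + s * D u V i))
    (\sum_j expR (- q j V) * - (kappa V * dot (z j) (A *m u))).
  have -> : (fun s : R => sum_exp q (fun i => V i + s * D u V i)) =
      fun s => \sum_j expR (- (q j V + s * (kappa V * dot (z j) (A *m u)))).
    apply/funext => s; apply: eq_bigr => j _.
    by rewrite /q PD dotDr dotZr mulrA.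
  apply: is_derive_bigsum => j; set a := kappa V * _.
  have dq : is_derive (0 : R) (1 : R) (fun s : R => q j V + s * a) a.
    have -> : (fun s : R => q j V + s * a) = cst (q j V) + a \*: id.
      by apply/funext => s /=; rewrite fctE /= /GRing.scale /= mulrC.
    by apply: is_derive_eq; rewrite /GRing.scale /= mulr1 add0r.
  have := @is_derive1_comp _ expR (fun s => - (q j V + s * a)) 0 _ _
    (is_derive_expR _) (is_deriveN dq).
  by rewrite mul0r addr0.
have := @derive_val _ _ _ _ _ _ _ d1; rewrite (@derive_val _ _ _ _ _ _ _ d2).
have -> : (fun i => V i + 0 * D u V i) = V.
  by apply/funext => i; rewrite mul0r addr0.
rewrite /pdot => <-; rewrite mulr_sumr -sumrN; apply: eq_bigr => j _.
by ring.
Qed.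

Variables (W : R -> I -> R) (t0 : R).
Hypotheses (flow : gradient_flow (sum_exp q) W).
Hypotheses (t0_gt0 : 0 < t0) (loss_t0 : sum_exp q (W t0) < 1).

(** By Cauchy-Schwarz, a margin of order [|W|^(N+1)] forces a predictor of that order. Errors
    measured by the weights can thus be absorbed into the norm of the predictor. *)
Lemma flow_predictor_margin : exists2 c, 0 < c & forall t, t0 <= t ->
  c ^+ 2 * pdot (W t) (W t) ^+ N.+1 <= dot (z j0) (z j0) * dot (P (W t)) (P (W t)).
Proof.
have [c c0 Hc] := flow_margin (ltn0Sn N) q_form j0 flow t0_gt0 loss_t0.
exists c => // t t0t; apply: le_trans (dot_cauchy_schwarz _ _).
rewrite -[X in _ * X ^+ _]sqr_sqrtr ?pdot_ge0// exprAC -exprMn.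
have c1 : 0 <= c * Num.sqrt (pdot (W t) (W t)) ^+ N.+1.
  by rewrite mulr_ge0 ?exprn_ge0 ?(ltW c0).
by rewrite lerXn2r ?nnegrE//; [exact: le_trans (Hc t t0t j0)|exact: Hc].
Qed.

Lemma flow_margin_gt0 t : t0 <= t -> forall j, 0 < q j (W t).
Proof.
move=> t0t j; apply: lt_le_trans (loss_margin q j0 (W t) j).
rewrite oppr_gt0 -ln1 ltr_ln ?posrE ?(loss_gt0 q j0)//.
exact: (flow_loss_lt1 q_form flow t0_gt0 loss_t0).
Qed.

(* When [W] is almost aligned with the negative gradient, testing both with
   [D u W] shows that the predictor is almost proportional to a combination of
   the [A^T z j] with weights [expR (- q j W)]. *)
Lemma aligned_predictor e V : 0 < e ->
  0 < - pdot (partial (sum_exp q) V) V ->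
  pdot (partial (sum_exp q) V) (partial (sum_exp q) V) * pdot V V <
    (1 + e) * (- pdot (partial (sum_exp q) V) V) ^+ 2 ->
  exists2 c, 0 <= c & forall u,
  (dot u (P V) - c * \sum_j expR (- q j V) * dot (z j) (A *m u)) ^+ 2 <=
  e * K * dot u u * pdot V V ^+ N.+1.
Proof.
set g := partial _ _; set S := pdot V V; set nu := - pdot g V => e0 nu0 al.
have S0 : 0 <= S by exact: pdot_ge0.
exists (S / nu * kappa V) => [|u]; first by rewrite mulr_ge0 ?divr_ge0// ltW.
(* The multiple of the gradient makes [w] orthogonal to [V]; alignment then makes [w] short. *)
pose w i := 1 * V i + S / nu * g i.
have ww : pdot w w <= e * S.
  rewrite pdot_sqr_comb -/S (pdotC V g) -[pdot g V]opprK -/nu.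
  have -> : 1 ^+ 2 * S + 2 * (1 * (S / nu)) * - nu + (S / nu) ^+ 2 * pdot g g =
      S / nu ^+ 2 * (pdot g g * S) - S.
    by field; rewrite gt_eqF.
  rewrite lerBlDr -[e * S + S](_ : S / nu ^+ 2 * ((1 + e) * nu ^+ 2) = _).
    by apply: ler_wpM2l (ltW al); rewrite divr_ge0// sqr_ge0.
  by field; rewrite gt_eqF.
have -> : dot u (P V) - S / nu * kappa V *
    (\sum_j expR (- q j V) * dot (z j) (A *m u)) = pdot w (D u V).
  rewrite pdot_comb mul1r VD -mulrA -loss_directional_derivative -/g.
  by ring.
apply: le_trans (pdot_cauchy_schwarz _ _) _.
apply: le_trans (ler_pM (pdot_ge0 _) (pdot_ge0 _) ww (DD u V)) _.
by rewrite -/S exprS le_eqVlt; apply/orP; left; apply/eqP; ring.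
Qed.

(** At a late aligned time the approximation of the predictor is tested against the predictor itself
    and against [u]. Both tests involve the same factor [mu], and eliminating it leaves the product
    on the right. *)
Lemma flow_predictor_frequently eta u m j t1 : 0 < eta -> eta < 1 -> 0 <= m ->
  (forall i, m <= dot (z i) (A *m u)) ->
  exists2 t, t1 <= t & m * (1 - eta) <=
    (dot u (direction (P (W t))) + eta * enorm u) *
    (dot (z j) (direction (P (W t))) + eta).
Proof.
move=> eta0 eta1 m0 Hu.
have [c c0 Hc] := flow_predictor_margin.
set Z := dot (z j0) (z j0) in Hc; have Z0 : 0 <= Z by exact: dot_ge0.
pose n : R := #|J|%:R; have n0 : 0 <= n by [].
have KZ0 : 0 <= K * Z by rewrite mulr_ge0.
(* This [e] turns the error of [aligned_predictor] into a fraction [eta] of the predictor norm; the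
   added 1 keeps the denominator positive. *)
pose e := eta ^+ 2 * c ^+ 2 / (K * Z + 1).
have e0 : 0 < e by rewrite divr_gt0 ?mulr_gt0 ?exprn_gt0// ltr_wpDl.
have eKZ : e * K * Z <= eta ^+ 2 * c ^+ 2.
  have KZ1 : 0 < K * Z + 1 by rewrite ltr_wpDl.
  have -> : e * K * Z = eta ^+ 2 * c ^+ 2 * (K * Z / (K * Z + 1)).
    by rewrite /e; field; rewrite gt_eqF.
  have KZ_le1 : K * Z / (K * Z + 1) <= 1 by rewrite ler_pdivrMr// mul1r lerDl.
  by rewrite ler_piMr// mulr_ge0 ?sqr_ge0.
clearbody e.
(* The threshold gives [1 <= S], so that powers of [S] dominate [S], and a predictor norm [b] with
   [n <= eta * b]. *)
have [t2 t02 Ht2] := flow_norm_unbounded (ltn0Sn N) q_form j0 flow t0_gt0 loss_t0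
  (1 + Z * (n / eta) ^+ 2 / c ^+ 2).
have [t [t0t t12 al]] := flow_alignment (ltn0Sn N) q_form j0 flow t0_gt0 loss_t0
  (Num.max t1 t2) e0.
have {t12} [t1t t2t] : t1 <= t /\ t2 <= t by apply/andP; rewrite -ge_max.
exists t => //.
have nu0 := flow_radial_gt0 (ltn0Sn N) q_form j0 flow t0_gt0 loss_t0 t0t.
have qt0 := flow_margin_gt0 t0t.
have F0 := loss_gt0 q j0 (W t).
have [a a0 Ha] := aligned_predictor e0 nu0 al.
move: {Hc Ht2 al nu0} (Hc t t0t) (Ht2 t t2t) => Hc HS.
set S := pdot (W t) (W t) in Hc HS Ha.
set b := enorm (P (W t)).
have b2 : dot (P (W t)) (P (W t)) = b ^+ 2 by rewrite enorm_sqr.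
have b0 : 0 <= b by exact: enorm_ge0.
rewrite b2 in Hc.
have c20 : 0 < c ^+ 2 by rewrite exprn_gt0.
have S1 : 1 <= S.
  apply: le_trans HS; rewrite lerDl; apply: divr_ge0; last exact: ltW.
  by apply: mulr_ge0 => //; exact: sqr_ge0.
have nb : n <= eta * b.
  rewrite mulrC -ler_pdivrMr// leNgt; apply/negP => bn.
  have : c ^+ 2 * S <= Z * (n / eta) ^+ 2.
    apply: (@le_trans _ _ (Z * b ^+ 2)); last first.
      by rewrite ler_wpM2l// lerXn2r ?nnegrE ?(ltW bn)// divr_ge0// ltW.
    apply: le_trans Hc; rewrite ler_wpM2l ?(ltW c20)//.
    by rewrite -[leLHS]expr1 ler_weXn2l.
  rewrite leNgt => /negP; apply.
  rewrite [c ^+ 2 * _]mulrC -ltr_pdivrMr//; apply: lt_le_trans HS.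
  by rewrite ltrDr.
have approx v : `|dot v (P (W t)) -
    a * \sum_i expR (- q i (W t)) * dot (z i) (A *m v)| <= eta * enorm v * b.
  apply: ler_norm_sqr; first by rewrite !mulr_ge0 ?enorm_ge0// ltW.
  apply: le_trans (Ha v) _.
  rewrite !exprMn enorm_sqr -(ler_pM2l c20).
  have -> : c ^+ 2 * (e * K * dot v v * S ^+ N.+1) =
      e * K * dot v v * (c ^+ 2 * S ^+ N.+1) by ring.
  apply: (@le_trans _ _ (e * K * dot v v * (Z * b ^+ 2))).
    by rewrite ler_wpM2l// !mulr_ge0 ?dot_ge0// ltW.
  have -> : e * K * dot v v * (Z * b ^+ 2) = e * K * Z * (dot v v * b ^+ 2) by ring.
  have -> : c ^+ 2 * (eta ^+ 2 * dot v v * b ^+ 2) =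
    eta ^+ 2 * c ^+ 2 * (dot v v * b ^+ 2) by ring.
  by rewrite ler_wpM2r// mulr_ge0 ?dot_ge0 ?sqr_ge0.
have b_gt0 : 0 < b.
  rewrite lt_def b0 andbT; apply/eqP => b_eq0; move: Hc.
  rewrite b_eq0 expr0n mulr0 leNgt => /negP; apply.
  by rewrite mulr_gt0// exprn_gt0// (lt_le_trans ltr01).
pose mu := a * sum_exp q (W t).
have mu0 : 0 <= mu by rewrite mulr_ge0// ltW.
have H1 : (1 - eta) * b ^+ 2 <= mu * (q j (W t) + n).
  have := approx (P (W t)); rewrite ler_norml => /andP[_].
  rewrite AP b2 -/b => H.
  have := ler_wpM2l a0 (sum_exp_margin q (W t) j); rewrite -/n => H'.
  rewrite /mu -mulrA (mulrC (sum_exp _ _)); apply: le_trans H'.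
  by move: H; rewrite /q; lra.
have H2 : mu * m <= dot u (P (W t)) + eta * enorm u * b.
  have := approx u; rewrite ler_norml => /andP[H _].
  have H' : m * sum_exp q (W t) <= \sum_i expR (- q i (W t)) * dot (z i) (A *m u).
    rewrite mulr_sumr ler_sum// => i _.
    by rewrite mulrC ler_wpM2l ?expR_ge0.
  have := ler_wpM2l a0 H'; rewrite /mu -mulrA (mulrC _ m); lra.
have dir v : dot v (P (W t)) = b * dot v (direction (P (W t))).
  by rewrite dotZr mulrA mulfV ?mul1r// gt_eqF.
rewrite -(ler_pM2l (exprn_gt0 2 b_gt0)).
apply: (@le_trans _ _ ((dot u (P (W t)) + eta * enorm u * b) * (q j (W t) + eta * b))); last first.
  by rewrite /q !dir le_eqVlt; apply/orP; left; apply/eqP; ring.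
apply: (@le_trans _ _ (mu * m * (q j (W t) + n))).
  have -> : b ^+ 2 * (m * (1 - eta)) = m * ((1 - eta) * b ^+ 2) by ring.
  by rewrite (mulrC mu) -mulrA ler_wpM2l.
apply: ler_pM => //; first exact: mulr_ge0.
  by apply: addr_ge0 => //; exact: ltW (qt0 j).
by rewrite lerD2l.
Qed.

Lemma flow_direction b : direction (P (W t)) @[t --> +oo] --> b ->
  [/\ dot b b <= 1, forall j, 0 < dot (z j) b &
    forall u m, 0 <= m -> (forall j, m <= dot (z j) (A *m u)) ->
      forall j, m <= dot u b * dot (z j) b].
Proof.
move=> lim_b.
have lim_dot v : dot v (direction (P (W t))) @[t --> +oo] --> dot v b.
  by apply: dot_cvg lim_b; exact: cvg_cst.
have opt u m : 0 <= m -> (forall j, m <= dot (z j) (A *m u)) ->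
    forall j, m <= dot u b * dot (z j) b.
  move=> m0 Hu j.
  have Heta eta : 0 < eta -> eta < 1 ->
      m * (1 - eta) <= (dot u b + eta * enorm u) * (dot (z j) b + eta).
    move=> eta0 eta1; apply: (@cvg_pinfty_ge _ (fun t =>
      (dot u (direction (P (W t))) + eta * enorm u) *
      (dot (z j) (direction (P (W t))) + eta))).
      by apply: cvgM; (apply: cvgD; first exact: lim_dot); exact: cvg_cst.
    by move=> t1; exact: flow_predictor_frequently.
  (* [C] dominates the coefficients of [eta] in [Heta], using [eta * eta <= eta]; the added 1 makes
     it positive. *)
  pose C := `|m| + `|dot u b| + enorm u * `|dot (z j) b| + enorm u + 1.
  have C0 : 0 < C.
    by rewrite ltr_wpDl// !addr_ge0 ?mulr_ge0 ?enorm_ge0.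
  apply/ler_addgt0Pr => e e0.
  pose eta := Num.min (1 / 2) (e / C).
  have eta0 : 0 < eta by rewrite lt_min !divr_gt0.
  have eta1 : eta < 1 by rewrite gt_min; apply/orP; left; lra.
  have etaC : eta * C <= e by rewrite -ler_pdivlMr// ge_min lexx orbT.
  have := Heta _ eta0 eta1.
  have : eta * m <= eta * `|m| by rewrite ler_wpM2l ?ler_norm// ltW.
  have : eta * dot u b <= eta * `|dot u b| by rewrite ler_wpM2l ?ler_norm// ltW.
  have : eta * enorm u * dot (z j) b <= eta * enorm u * `|dot (z j) b|.
    by rewrite ler_wpM2l ?ler_norm// mulr_ge0 ?enorm_ge0// ltW.
  have : eta * eta * enorm u <= eta * enorm u.
    by rewrite -mulrA ler_piMl ?mulr_ge0 ?enorm_ge0 ?ltW.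
  move: etaC; rewrite /C; lra.
split=> //.
- rewrite -lerN2; apply: (@cvg_pinfty_ge _ (fun t =>
    - dot (direction (P (W t))) (direction (P (W t))))).
    by apply: cvgN; exact: dot_cvg.
  by move=> t1; exists t1 => //; rewrite lerN2 dot_direction_le1.
- move=> j; have dir_ge0 : 0 <= dot (z j) b.
    apply: (cvg_pinfty_ge (lim_dot (z j))) => t1; exists (Num.max t0 t1).
      by rewrite le_max lexx orbT.
    rewrite dotZr mulr_ge0 ?invr_ge0 ?enorm_ge0//.
    by apply/ltW/flow_margin_gt0; rewrite le_max lexx.
  (* Passing to the limit gives only a weak inequality. Strictness comes from [opt] with [u] the
     predictor at [t0], whose margins are at least [m > 0]. *)
  have [c c0 Hc] := flow_margin (ltn0Sn N) q_form j0 flow t0_gt0 loss_t0.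
  pose m := c * Num.sqrt (pdot (W t0) (W t0)) ^+ N.+1.
  have m0 : 0 < m.
    rewrite mulr_gt0// exprn_gt0// sqrtr_gt0.
    exact: (small_loss_pdot_gt0 (ltn0Sn N) q_form j0 loss_t0).
  have := opt (P (W t0)) m (ltW m0); rewrite AP => /(_ (Hc t0 (lexx t0)) j).
  rewrite lt_def dir_ge0 andbT; apply: contraTneq => ->.
  by rewrite mulr0 -ltNge.
Qed.

End FlowDirection.

(** * Networks with an unconstrained first layer *)

Lemma dot_projection_le (R : realType) (d : nat) (A : 'M[R]_d) (u : 'cV[R]_d) :
  A^T = A -> A *m A = A -> dot (A *m u) (A *m u) <= dot u u.
Proof.
move=> symA idA.
have AuE : dot (A *m u) (A *m u) = dot u (A *m u).
  by rewrite dot_mulmx symA mulmxA idA dotC.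
have := dot_cauchy_schwarz u (A *m u).
rewrite -AuE expr2.
have [->|Au0] := eqVneq (dot (A *m u) (A *m u)) 0; first by rewrite dot_ge0.
by rewrite ler_pM2r// lt_def Au0 dot_ge0.
Qed.

Lemma pdot_sum (R : realType) (I I' : finType) (U V : I + I' -> R) :
  pdot U V = pdot (U \o inl) (V \o inl) + pdot (U \o inr) (V \o inr).
Proof. by rewrite /pdot big_sumType. Qed.

Lemma pdot_prod (R : realType) (I J : finType) (U V : I * J -> R) :
  pdot U V = \sum_i \sum_j U (i, j) * V (i, j).
Proof. by rewrite pair_bigA; apply: eq_bigr => -[]. Qed.

Lemma form_vector_bound (R : realType) (I : finType) (d N : nat)
    (M : (I -> R) -> 'cV[R]_d) :
  (forall j, form N (fun V => M V j 0)) -> exists2 K, 0 <= K &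
    forall V, dot (M V) (M V) <= K * pdot V V ^+ N.
Proof.
move=> /(fun H j => form_bound (H j)) HM.
have /choice[C HC] : forall j, exists C, 0 <= C /\ forall W r, 0 <= r ->
    (forall i, `|W i| <= r) -> `|M W j 0| <= C * r ^+ N.
  by move=> j; have [C C0 H] := HM j; exists C.
exists (\sum_j C j ^+ 2) => [|V]; first by apply: sumr_ge0 => j _; exact: sqr_ge0.
rewrite /dot mulr_suml ler_sum// => j _; have [C0 {}HC] := HC j.
have := HC V (Num.sqrt (pdot V V)) (sqrtr_ge0 _) _.
have Vle i : `|V i| <= Num.sqrt (pdot V V).
  rewrite -sqrtr_sqr ler_wsqrtr// /pdot (bigD1 i)//= -expr2 lerDl.
  by apply: sumr_ge0 => k _; rewrite -expr2 sqr_ge0.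
move=> /(_ Vle) H.
rewrite -expr2 -real_normK ?num_real//.
rewrite -[X in _ * X ^+ _]sqr_sqrtr ?pdot_ge0// exprAC -exprMn.
by rewrite lerXn2r ?nnegrE// mulr_ge0// exprn_ge0.
Qed.

(** Here [M] gathers the later layers. Both architectures fit: the steerable one with [A] the group
    average, the fully-connected one with [A = 1]. *)
Lemma first_layer_flow_direction (R : realType) (I J : finType) (d d1 N : nat)
    (A : 'M[R]_d) (M : (I -> R) -> 'cV[R]_d1)
    (P : ('I_d * 'I_d1 + I -> R) -> 'cV[R]_d) (z : J -> 'cV[R]_d) (j0 : J)
    (W : R -> 'I_d * 'I_d1 + I -> R) (t0 : R) (b : 'cV[R]_d) :
  A^T = A -> A *m A = A -> (forall j, form N (fun V => M V j 0)) ->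
  (forall V, P V = A *m (\matrix_(i, j) V (inl (i, j)) *m M (V \o inr))) ->
  gradient_flow (sum_exp (fun j V => dot (z j) (P V))) W ->
  0 < t0 -> sum_exp (fun j V => dot (z j) (P V)) (W t0) < 1 ->
  direction (P (W t)) @[t --> +oo] --> b ->
  [/\ dot b b <= 1, forall j, 0 < dot (z j) b &
    forall u m, 0 <= m -> (forall j, m <= dot (z j) (A *m u)) ->
      forall j, m <= dot u b * dot (z j) b].
Proof.
move=> symA idA M_form PE; have [K K0 HK] := form_vector_bound M_form.
(* The first layer receives the rank-one change [(A *m u) *m M^T]. As [A] is idempotent, the
   predictor moves by [A *m u] times the squared norm of [M]. *)
pose D (u : 'cV[R]_d) (V : 'I_d * 'I_d1 + I -> R) (i : 'I_d * 'I_d1 + I) : R :=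
  match i with
  | inl ij => (A *m u) ij.1 0 * M (V \o inr) ij.2 0
  | inr _ => 0
  end.
have mxD u V s : \matrix_(i, j) (V (inl (i, j)) + s * D u V (inl (i, j))) =
    \matrix_(i, j) V (inl (i, j)) + s *: ((A *m u) *m (M (V \o inr))^T).
  apply/matrixP => i j; rewrite [LHS]mxE [RHS]mxE; congr (_ + _).
    by rewrite mxE.
  rewrite [RHS]mxE; congr (_ * _).
  by rewrite [RHS]mxE big_ord1 [X in _ * X]mxE.
have MD u V s : (fun i => V i + s * D u V i) \o inr = V \o inr.
  by apply/funext => i /=; rewrite mulr0 addr0.
have MM V : (M V)^T *m M V = (dot (M V) (M V))%:M.
  by rewrite dotE -mx11_scalar.
move=> flow t0_gt0 loss.
apply: (flow_direction (K := K) (D := D) (A := A)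
  (kappa := fun V => dot (M (V \o inr)) (M (V \o inr)))
  j0 _ _ _ _ _ _ _ flow t0_gt0 loss) => //.
- move=> i.
  have -> : (fun V => P V i 0) = fun V => \sum_k \sum_j
      A i k * (V (inl (k, j)) * M (V \o inr) j 0).
    apply/funext => V; rewrite PE mxE; apply: eq_bigr => k _.
    by rewrite mxE mulr_sumr; apply: eq_bigr => j _; rewrite mxE.
  apply: form_sum => k; apply: form_sum => j; apply: form_scale.
  rewrite -add1n; apply: form_mul; first exact: form_coord.
  exact: (form_reindex inr (M_form j)).
- by move=> V; rewrite PE mulmxA idA.
- by move=> V; exact: dot_ge0.
- move=> u V s; rewrite !PE MD mxD mulmxDl mulmxDr; congr (_ + _).
  rewrite -scalemxAl -mulmxA MM mul_mx_scalar scalerA -scalemxAr.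
  by rewrite mulmxA idA.
- move=> u V; rewrite PE dot_mulmx symA pdot_sum [X in _ + X]big1 => [|i _]; last first.
    by rewrite mulr0.
  rewrite addr0 pdot_prod /dot; apply: eq_bigr => i _; rewrite [X in _ = _ * X]mxE mulr_sumr; apply: eq_bigr => j _.
  by rewrite [X in _ = _ * (X * _)]mxE /=; ring.
- move=> u V; rewrite pdot_sum [X in _ + X]big1 => [|i _]; last by rewrite mulr0.
  have -> : pdot (D u V \o inl) (D u V \o inl) =
      dot (A *m u) (A *m u) * dot (M (V \o inr)) (M (V \o inr)).
    rewrite pdot_prod /dot mulr_suml; apply: eq_bigr => i _.
    by rewrite mulr_sumr; apply: eq_bigr => j _ /=; ring.
  rewrite addr0 [K * _]mulrC -mulrA.
  apply: ler_pM; rewrite ?dot_ge0 ?dot_projection_le//.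
  apply: le_trans (HK _) _; rewrite ler_wpM2l//.
  rewrite lerXn2r ?nnegrE ?pdot_ge0// [leRHS]pdot_sum lerDr.
  exact: pdot_ge0.
Qed.

Lemma exp_lossE (R : realType) (I J : finType) (d : nat)
    (P : (I -> R) -> 'cV[R]_d) (x : J -> 'cV[R]_d) (y : J -> R) :
  exp_loss P x y = sum_exp (fun j V => dot (y j *: x j) (P V)).
Proof. by apply/funext => V; apply: eq_bigr => j _; rewrite dotZl. Qed.

(** Each layer contributes one factor, hence one degree. *)
Lemma P_fc_form (R : realType) (ks : seq nat) (k : nat) (i : 'I_k) :
  form (size ks).+1 (fun V => @P_fc R k ks V i 0).
Proof.
elim: ks k i => [|k' ks IH] k i /=.
  have -> : (fun V : 'I_k -> R => (\col_i0 V i0) i 0) = fun V => V i.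
    by apply/funext => V; rewrite mxE.
  exact: form_coord.
set H := (H in form _ H).
have -> : H = fun V => \sum_j V (inl (i, j)) * @P_fc R k' ks (V \o inr) j 0.
  by apply/funext => V; rewrite /H mxE; apply: eq_bigr => j _; rewrite mxE.
apply: form_sum => j; rewrite -add1n; apply: form_mul; first exact: form_coord.
exact: (form_reindex inr (IH k' j)).
Qed.

(** * Invariance and homogeneity of the steerable layers *)

Section SteerableLayers.
Variables (R : realType) (gT : finGroupType).

Lemma layers_fun_sum (m : nat) (X : linear_rep R gT) (T : steer_layers m X) w
    (n : nat) (a : 'I_n -> R) (v : 'I_n -> X) :
  layers_fun (T := T) w (\sum_i a i *: v i) = \sum_i a i * layers_fun w (v i).
Proof.
have f0 : layers_fun (T := T) w 0 = 0.
  by have := layers_fun_linear w (-1) 0 0; rewrite scaler0 addr0 mulN1r addNr.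
by elim/big_rec2: _ => [//|i c u _ <-]; rewrite layers_fun_linear.
Qed.

(** The intertwiners carry the action through the layers to the output, where it is trivial. *)
Lemma layers_fun_invariant (m : nat) (X : linear_rep R gT) (T : steer_layers m X)
    w g (v : X) : layers_fun (T := T) w (rep_act g v) = layers_fun w v.
Proof.
elim: T w v => [{}X n psi|{}m {}X Y n psi tl IH] w v /=.
  by apply: eq_bigr => j _; rewrite (intertwinerP (psi j) g v).
rewrite -[RHS](IH _ _); congr layers_fun.
pose f : {linear Y -> Y} := HB.pack (rep_act (l := Y) g)
  (GRing.isLinear.Build _ _ _ _ _ (rep_act_linear (l := Y) g)).
rewrite -[RHS]/(f _) linear_sum; apply: eq_bigr => j _.
by rewrite linearZ /= (intertwinerP (psi j) g v).
Qed.

Lemma layers_fun_form (m : nat) (X : linear_rep R gT) (T : steer_layers m X)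
    (v : X) : form m (fun w => layers_fun (T := T) w v).
Proof.
elim: T v => [{}X n psi|{}m {}X Y n psi tl IH] v /=.
  apply: form_sum => j.
  have -> : (fun w : 'I_n -> R => w j *: psi j v) = fun w => (psi j v : R) * w j.
    by apply/funext => w; rewrite mulrC.
  exact/form_scale/form_coord.
set H := (H in form _ H).
have -> : H = fun w => \sum_j w (inl j) * layers_fun (T := tl) (w \o inr) (psi j v).
  by apply/funext => w; rewrite /H layers_fun_sum.
apply: form_sum => j; rewrite -add1n; apply: form_mul; first exact: form_coord.
exact: (form_reindex inr (IH (psi j v))).
Qed.

End SteerableLayers.

(** * Group averaging and the steerable predictor *)

Section GroupAverage.
Variables (R : realType) (gT : finGroupType) (d : nat).
Variable rho : mx_representation R [set: gT]%SET d.
Hypothesis unitary : forall g : gT, rho (g^-1)%g = (rho g)^T.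

(** Under [unitary], this is the orthogonal projection onto the vectors fixed by the group. *)
Definition avg_mx : 'M[R]_d := #|gT|%:R^-1 *: \sum_(g : gT) rho g.

Let reprM g h : rho (g * h)%g = rho g *m rho h.
Proof. by case: (rho) => r [r1 rM] /=; rewrite rM ?inE. Qed.

Let repr1 : rho 1%g = 1%:M.
Proof. by case: (rho) => r []. Qed.

Let invmx_repr g : invmx (rho g) = rho (g^-1)%g.
Proof.
have rV : rho g *m rho (g^-1)%g = 1%:M by rewrite -reprM mulgV repr1.
have [u _] := mulmx1_unit rV.
by rewrite -[LHS]mulmx1 -rV mulKmx.
Qed.

Let card_gT : #|gT|%:R != 0 :> R.
Proof. by rewrite pnatr_eq0 -lt0n; apply/card_gt0P; exists 1%g. Qed.

Lemma mul_repr_avg g : rho g *m avg_mx = avg_mx.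
Proof.
rewrite /avg_mx -scalemxAr mulmx_sumr; congr (_ *: _).
rewrite [RHS](reindex_inj (mulgI g)).
by apply: eq_bigr => h _; rewrite reprM.
Qed.

Lemma avg_mx_fixed (v : 'cV[R]_d) : (forall g, rho g *m v = v) -> avg_mx *m v = v.
Proof.
move=> fixv; rewrite -scalemxAl mulmx_suml (eq_bigr (fun=> v)) => [|g _]; last first.
  exact: fixv.
by rewrite sumr_const -[v *+ _]scaler_nat scalerA mulVf ?scale1r.
Qed.

Lemma avg_mx_idem : avg_mx *m avg_mx = avg_mx.
Proof.
rewrite {1}/avg_mx -scalemxAl mulmx_suml (eq_bigr (fun=> avg_mx)) => [|g _]; last first.
  exact: mul_repr_avg.
by rewrite sumr_const -[avg_mx *+ _]scaler_nat scalerA mulVf ?scale1r.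
Qed.

Lemma tr_avg_mx : avg_mx^T = avg_mx.
Proof.
rewrite /avg_mx linearZ /= linear_sum; congr (_ *: _).
rewrite [RHS](reindex_inj invg_inj).
by apply: eq_bigr => g _; rewrite unitary.
Qed.

(** A lower bound along the whole orbit of [u] passes to the mean. This converts margins on the
    augmented data into margins of [avg_mx *m v] on the original data. *)
Lemma dot_avg_ge (u v : 'cV[R]_d) m :
  (forall g, m <= dot (rho g *m u) v) -> m <= dot u (avg_mx *m v).
Proof.
move=> Hm; rewrite dot_mulmx tr_avg_mx.
rewrite -scalemxAl mulmx_suml dotZl mulrC ler_pdivlMr; last first.
  by rewrite lt_def card_gT ler0n.
rewrite dotC dotE mulmx_sumr summxE mulr_natr.
by rewrite -sumr_const; apply: ler_sum => g _; rewrite -dotE dotC.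
Qed.

Variables (d1 m : nat) (T : steer_layers m (regular_rep R gT d1)).

(** This is the response of the later layers to constant functions on the group. No other input
    matters, since an invariant vector has a constant lifting. *)
Definition steer_head (w : layers_idx T -> R) : 'cV[R]_d1 :=
  \col_k layers_fun w ([ffun=> delta_mx k 0] : regular_rep R gT d1).

Lemma f_steer_invariant (W : steer_idx d T -> R) g u :
  f_steer rho W (rho g *m u) = f_steer rho W u.
Proof.
rewrite /f_steer -[RHS](layers_fun_invariant _ g); congr layers_fun.
apply/ffunP => h; rewrite !ffunE !mulmxA -(mulmxA _ _ (rho g)) !invmx_repr.
by rewrite -reprM invMg invgK.
Qed.

Lemma P_steer_fixed (W : steer_idx d T -> R) g :
  rho g *m P_steer rho W = P_steer rho W.
Proof.
apply: (@P_steer_unique R gT d d1 m rho T) => u.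
rewrite dot_mulmx -unitary -f_steer_dot; symmetry.
exact: f_steer_invariant.
Qed.

Lemma P_steerE (W : steer_idx d T -> R) :
  P_steer rho W =
  avg_mx *m (\matrix_(i, j) W (inl (i, j)) *m steer_head (W \o inr)).
Proof.
symmetry; apply: P_steer_unique => u.
set w1 := (\matrix_(i, j) W (inl (i, j)) : 'M[R]_(d, d1)).
(* The predictor is a fixed vector, so averaging the input does not change the output. *)
have -> : f_steer rho W u = f_steer rho W (avg_mx *m u).
  rewrite !f_steer_dot -{1}(avg_mx_fixed (P_steer_fixed W)).
  by rewrite dot_mulmx tr_avg_mx.
rewrite /f_steer.
have -> : lifting rho w1 (avg_mx *m u) = \sum_k (w1^T *m (avg_mx *m u)) k 0 *:
    ([ffun=> delta_mx k 0] : regular_rep R gT d1).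
  apply/ffunP => g; rewrite sum_ffunE ffunE -mulmxA invmx_repr.
  rewrite [rho _ *m _]mulmxA mul_repr_avg [LHS]matrix_sum_delta.
  by apply: eq_bigr => k _; rewrite big_ord1 !ffunE.
rewrite layers_fun_sum dot_mulmx tr_avg_mx dot_mulmx.
by apply: eq_bigr => k _; rewrite [steer_head _ _ _]mxE.
Qed.

Lemma steer_head_form k : form m (fun w => steer_head w k 0).
Proof.
have -> : (fun w => steer_head w k 0) = fun w =>
    layers_fun (T := T) w ([ffun=> delta_mx k 0] : regular_rep R gT d1).
  by apply/funext => w; rewrite mxE.
exact: layers_fun_form.
Qed.

End GroupAverage.

(** * Comparison of the two limit directions *)

Theorem corollary5p1 (R : realType) (gT : finGroupType) (d0 : nat)
  (rho0 : mx_representation R [set: gT]%SET d0)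
  (n : nat) (n_gt0 : (0 < n)%N)
  (x : 'I_n -> 'cV[R]_d0) (y : 'I_n -> R)
  (y_pm1 : forall i, y i = 1 \/ y i = -1)
  (L : nat) (L_ge2 : (2 <= L)%N)
  (d1 : nat) (T : steer_layers L.-1 (regular_rep R gT d1))
  (W_steer : R -> steer_idx d0 T -> R)
  (flow_steer : gradient_flow (exp_loss (P_steer rho0 (T := T)) x y) W_steer)
  (loss_steer : exists2 t0 : R, 0 < t0 &
     exp_loss (P_steer rho0 (T := T)) x y (W_steer t0) < 1)
  (beta_steer : 'cV[R]_d0)
  (lim_steer :
     direction (P_steer rho0 (W_steer t)) @[t --> +oo] --> beta_steer)
  (ks : seq nat) (size_ks : size ks = L.-1)
  (ks_gt0 : all (fun k => 0 < k)%N ks)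
  (W_fc : R -> fc_idx d0 ks -> R)
  (flow_fc :
     gradient_flow (exp_loss (@P_fc R d0 ks) (aug_x rho0 x) (aug_y y)) W_fc)
  (loss_fc : exists2 t0' : R, 0 < t0' &
     exp_loss (@P_fc R d0 ks) (aug_x rho0 x) (aug_y y) (W_fc t0') < 1)
  (beta_fc : 'cV[R]_d0)
  (lim_fc : direction (P_fc (W_fc t)) @[t --> +oo] --> beta_fc)
  (unitary : forall g : gT, rho0 (g^-1)%g = (rho0 g)^T) :
  beta_steer = beta_fc.
Proof.
pose i0 := Ordinal n_gt0.
move: loss_steer flow_steer loss_fc flow_fc; rewrite !exp_lossE.
move=> [t0 t0_gt0 loss_steer] flow_steer [t0' t0'_gt0 loss_fc] flow_fc.
have [steer_le1 steer_gt0 steer_opt] :=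
  first_layer_flow_direction i0 (tr_avg_mx unitary) (avg_mx_idem rho0)
    (steer_head_form T) (P_steerE unitary (T := T))
    flow_steer t0_gt0 loss_steer lim_steer.
have [fc_le1 fc_gt0 fc_opt] : [/\ dot beta_fc beta_fc <= 1,
    forall ig, 0 < dot (aug_y y ig *: aug_x rho0 x ig) beta_fc &
    forall u m, 0 <= m ->
      (forall ig, m <= dot (aug_y y ig *: aug_x rho0 x ig) u) ->
      forall ig, m <= dot u beta_fc * dot (aug_y y ig *: aug_x rho0 x ig) beta_fc].
  (* Exposing the first layer needs a nonempty list of hidden widths, which [L_ge2] provides. *)
  case: ks size_ks {ks_gt0} W_fc loss_fc flow_fc lim_fc => [|k ks] size_ks.
    by case: (L) L_ge2 size_ks => [|[]].
  move=> W_fc loss_fc flow_fc lim_fc.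
  have PE (V : fc_idx d0 (k :: ks) -> R) : P_fc V =
      1%:M *m (\matrix_(i, j) V (inl (i, j)) *m P_fc (V \o inr)).
    by rewrite mul1mx.
  have [? ? fc_opt] := first_layer_flow_direction (i0, 1%g) (trmx1 _ _) (mul1mx _)
    (@P_fc_form R ks k) PE flow_fc t0'_gt0 loss_fc lim_fc.
  by split=> // u m m0 Hu; apply: fc_opt => // ig; rewrite mul1mx.
(* Invariance of the predictor passes to its limit, so the steerable limit has the same margins on
   the augmented data as on [S]. *)
have steer_fixed g u : dot (rho0 g *m u) beta_steer = dot u beta_steer.
  have lim_dot v : dot v (direction (P_steer rho0 (W_steer t))) @[t --> +oo] -->
      dot v beta_steer by apply: dot_cvg lim_steer; exact: cvg_cst.
  have dirE : (fun t => dot (rho0 g *m u) (direction (P_steer rho0 (W_steer t)))) =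
      fun t => dot u (direction (P_steer rho0 (W_steer t))).
    apply/funext => t; rewrite dotC dot_mulmx -unitary -scalemxAr.
    by rewrite P_steer_fixed// dotC.
  have := lim_dot (rho0 g *m u); rewrite dirE => lim_u.
  exact: cvg_unique lim_u (lim_dot u).
pose sm i := dot (y i *: x i) beta_steer.
pose fm ig := dot (aug_y y ig *: aug_x rho0 x ig) beta_fc.
have [i _ Hi] := @arg_minP _ _ _ i0 predT sm isT.
have [ig _ Hig] := @arg_minP _ _ _ (i0, 1%g) predT fm isT.
have fs : fm ig <= dot beta_fc beta_steer * sm i.
  apply: steer_opt; first exact: ltW (fc_gt0 ig).
  move=> j; apply: dot_avg_ge => // g.
  by have := Hig (j, g) isT; rewrite [fm (j, g)]/fm /aug_x /aug_y /= scalemxAr.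
have sf : sm i <= dot beta_steer beta_fc * fm ig.
  apply: fc_opt; first exact: ltW (steer_gt0 i).
  move=> [j g]; rewrite /aug_x /aug_y /= scalemxAr steer_fixed.
  exact: Hi.
(* With [c] the inner product of the limits, adding [fs] and [sf] gives [a + b <= c * (a + b)] for
   the positive minimal margins [a] and [b]. *)
have c_ge1 : 1 <= dot beta_steer beta_fc.
  have a0 : 0 < sm i by exact: steer_gt0.
  have b0 : 0 < fm ig by exact: fc_gt0.
  rewrite dotC in fs; rewrite -(ler_pM2r (addr_gt0 a0 b0)); lra.
(* The squared distance of the limits is at most [1 + 1 - 2 * c], hence at most 0. *)
apply/subr0_eq/dot_le0_eq0.
rewrite -scaleN1r dotDr dotZr ![dot (_ + _) _]dotC !dotDr !dotZr (dotC beta_fc).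
by move: steer_le1 fc_le1 c_ge1; lra.
Qed.
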